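(* Let $f(x;w)$ be a ResNet or a DenseNet (as defined in the context), with all weights i.i.d. standard normal, evaluated at a fixed input $x\in\mathbb{R}^{n_0}$ with $\|x\|_2=1$. Then for every non-negative even integer $m$ and every weight matrix $W^{\mathbf{k}}$ of the network, $$\mathbb{E}_w\big[(f_{(\mathbf{k})}(x;w))^{m}\big]=\mathbb{E}_w\big[(f_{\mathbf{k}}(x;w))^{m}\big].$$
   Context: $\phi(t)=\max(0,t)$ is the ReLU, applied coordinatewise. All weight entries are i.i.d. $\mathcal{N}(0,1)$. ResNet with residual branches of depth $m_b$: $f(x;w)=\frac{1}{\sqrt{n_L}}W^{L}y^L$ with final projection $W^{L}$ a row vector (distinct from the branch matrices $W^{L,h}$); $y^0=\frac{1}{\sqrt{n_0}}W^0x$; for $l\in[L]$, $y^l=y^{l-1}+\sqrt{\alpha_l}\,y^{l-1,m_b}$, where $y^{l-1,1}=\frac{1}{\sqrt{n_{l-1}}}W^{l,1}y^{l-1}$, $y^{l-1,h}=\frac{1}{\sqrt{n_{l-1,h-1}}}W^{l,h}q^{l-1,h-1}$ for $1<h\le m_b$, and $q^{l-1,h}=\sqrt2\,\phi(y^{l-1,h})$; $\alpha_l>0$ are scaling constants, $n_{l-1,h}$ is the dimension of $y^{l-1,h}$, $n_l$ that of $y^l$, and dimensions are compatible (so all $y^l$ have the same dimension). DenseNet: $f(x;w)=\frac{1}{\sqrt{n_L}}W^{L}y^L$ (final row-vector projection $W^L$); $y^0=\frac{1}{\sqrt{n_0}}W^0x$; for $l\in[L]$, $y^l=\sqrt{\frac{\alpha}{n_{l-1}\,l}}\sum_{h=0}^{l-1}W^{l,h}q^h$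 with $q^h=\sqrt2\,\phi(y^h)$, $\alpha>0$, and $W^{l,h}$ having $n_l$ rows and as many columns as the dimension of $q^h$. Path decomposition: for fixed $x,w$, $f(x;w)=\sum_{\gamma\in S}c_\gamma z_\gamma\prod_{l=1}^{|\gamma|}w_{\gamma,l}$, where $S$ is the set of input-to-output paths in the computation graph (through weight edges, identity skip connections and concatenations), $w_{\gamma,l}$ are the weights along $\gamma$, $c_\gamma$ collects the constant factors (scalings, $\sqrt2$'s, input coordinate), and $z_\gamma\in\{0,1\}$ indicates that all ReLUs along $\gamma$ are active. For a weight matrix $W^{\mathbf{k}}$, let $S_{\mathbf{k}}$ be the paths using a weight of $W^{\mathbf{k}}$, and $f_{\mathbf{k}}(x;w)=\sum_{\gamma\in S_{\mathbf{k}}}c_\gamma z_\gamma\prod_l w_{\gamma,l}$. Reduced network $f_{(\mathbf{k})}(x;w)$: the network obtained from $f$ by removing all connections bypassing $W^{\mathbf{k}}$ (same weights, recomputed activations). Concretely, for a ResNet and $\mathbf{k}=(l_k,h)$ a branch matrix, the recursion at layer $l_k$ becomes $y^{l_k}=\sqrt{\alpha_{l_k}}\,y^{l_k-1,m_b}$ (identity term dropped), all else unchanged; for a DenseNet and $\mathbf{k}=(l_k,h_k)$, $y^{l_k}=\sqrt{\frac{\alpha}{n_{l_k-1}l_k}}W^{l_k,h_k}q^{h_k}$ and for $l>l_k$, $y^l=\sqrt{\frac{\alpha}{n_{l-1}l}}\sum_{h=l_k}^{l-1}W^{l,h}q^h$; for the first and last projections $W^0,W^L$ nothing is removed. *)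

(* Defs.v *)
From HB Require Import structures.
From mathcomp Require Import all_boot all_order all_algebra.
From mathcomp Require Import all_classical all_reals all_analysis.
Set Implicit Arguments.
Unset Strict Implicit.
Unset Printing Implicit Defensive.
Import Order.TTheory GRing.Theory Num.Theory.
Local Open Scope ring_scope.

(* Identifier of a weight matrix:
   Win        = W^0       (first projection),
   Wmid l h   = W^{l,h}   (ResNet branch matrix / DenseNet matrix),
   Wout       = W^L       (final row-vector projection).               *)
Inductive wid := Win | Wmid of nat & nat | Wout.

Definition wid_code (a : wid) : nat * nat * nat :=
  match a with Win => (0, 0, 0) | Wmid l h => (1, l, h) | Wout => (2, 0, 0) end%N.
Definition wid_decode (c : nat * nat * nat) : wid :=
  match c with (0, _, _) => Win | (1, l, h) => Wmid l h | _ => Wout end%N.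
Lemma wid_codeK : cancel wid_code wid_decode. Proof. by case. Qed.
HB.instance Definition _ := Equality.copy wid (can_type wid_codeK).

(* A weight entry: (matrix, row, column). *)
Definition wkey := (wid * nat * nat)%type.
Definition weights (R : realType) := wkey -> R.
Definition W (R : realType) (w : weights R) (k : wid) (i j : nat) : R := w (k, i, j).

Definition mat_keys (k : wid) (r c : nat) : seq wkey :=
  [seq (k, i, j) | i <- iota 0 r, j <- iota 0 c].

Definition relu (R : realType) (t : R) : R := Num.max 0 t.
Definition gate (R : realType) (t : R) : R := if 0 < t then 1 else 0.
Definition sq2 (R : realType) : R := Num.sqrt 2.
Definition isq (R : realType) (n : nat) : R := (Num.sqrt (n%:R))^-1.

Definition upd (R : realType) (w : weights R) (k : wkey) (t : R) : weights R :=
  fun k' => if k' == k then t else w k'.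

(* gexp s G = E[G(w)] where the entries listed in s are i.i.d. N(0,1)
   (iterated integrals against the standard normal law); entries not in s
   are set to 0 (they are never read by the networks below). *)
Fixpoint gexp (R : realType) (s : seq wkey) (G : weights R -> \bar R) : \bar R :=
  match s with
  | [::] => G (fun _ => 0)
  | k :: s' => (\int[normal_prob (0:R) 1]_t gexp s' (fun w => G (upd w k t)))%E
  end.

(* m-th moment E_w[F(w)^m] (used for even m, where F^m >= 0). *)
Definition Emom (R : realType) (s : seq wkey) (F : weights R -> R) (m : nat) : \bar R :=
  gexp s (fun w => ((F w) ^+ m)%:E).

(* n0 = input dimension, n = dimension of every y^l, L = number of blocks,
   mb = depth of the residual branches,
   d l h = dimension n_{l-1,h} of y^{l-1,h} for 1 <= h < mb
   (y^{l-1,mb} has dimension n). *)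
Record resnet_arch := ResNetArch {
  rn_n0 : nat; rn_n : nat; rn_L : nat; rn_mb : nat; rn_d : nat -> nat -> nat }.

(* dimension of y^{l-1,h}; h = 0 stands for y^{l-1} itself *)
Definition rdim (A : resnet_arch) (l h : nat) : nat :=
  if h == 0%N then rn_n A else if h == rn_mb A then rn_n A else rn_d A l h.

(* y^{l-1,h} computed from yprev = y^{l-1}, (h = 0 gives y^{l-1}) *)
Fixpoint rn_branch (R : realType) (A : resnet_arch) (w : weights R) (l : nat)
    (yprev : nat -> R) (h : nat) : nat -> R :=
  match h with
  | 0 => yprev
  | h'.+1 => fun j => isq R (rdim A l h') *
      \sum_(i < rdim A l h') W w (Wmid l h'.+1) j i *
        (if h' == 0%N then rn_branch A w l yprev h' i
         else sq2 R * relu (rn_branch A w l yprev h' i))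
  end.

(* y^l; the identity skip connection of block `drop` is removed
   (drop = 0: nothing removed, blocks are numbered 1..L) *)
Fixpoint rn_y (R : realType) (A : resnet_arch) (alpha : nat -> R) (w : weights R)
    (x : nat -> R) (drop : nat) (l : nat) : nat -> R :=
  match l with
  | 0 => fun j => isq R (rn_n0 A) * \sum_(i < rn_n0 A) W w Win j i * x i
  | l'.+1 => fun j =>
      (if l'.+1 == drop then 0 else rn_y A alpha w x drop l' j)
      + Num.sqrt (alpha l'.+1) *
          rn_branch A w l'.+1 (rn_y A alpha w x drop l') (rn_mb A) j
  end.

Definition rn_out (R : realType) (A : resnet_arch) (alpha : nat -> R) (w : weights R)
    (x : nat -> R) (drop : nat) : R :=
  isq R (rn_n A) * \sum_(j < rn_n A) W w Wout 0 j * rn_y A alpha w x drop (rn_L A) j.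

Definition rn_f (R : realType) A alpha (w : weights R) x := rn_out A alpha w x 0.

Definition rn_reduced (R : realType) A alpha (w : weights R) x (k : wid) : R :=
  match k with Wmid l _ => rn_out A alpha w x l | _ => rn_out A alpha w x 0 end.

(* Path sums.  For every neuron, the pair (sum over all input->neuron
   paths gamma of c_gamma z_gamma prod w_gamma,
   same sum restricted to paths using an entry of W^k), computed by
   splitting each path at its last edge.  Gates z are those of f(x;w). *)
Fixpoint rn_psbranch (R : realType) (A : resnet_arch) (w : weights R) (l : nat)
    (yprev : nat -> R) (PA PB : nat -> R) (k : wid) (h : nat)
    : (nat -> R) * (nat -> R) :=
  match h with
  | 0 => (PA, PB)
  | h'.+1 =>
      let Q := rn_psbranch A w l yprev PA PB k h' in
      let g := fun i : nat => if h' == 0%N then 1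
                  else sq2 R * gate (rn_branch A w l yprev h' i) in
      (fun j => isq R (rdim A l h') *
          \sum_(i < rdim A l h') W w (Wmid l h'.+1) j i * g i * Q.1 i,
       fun j => isq R (rdim A l h') *
          \sum_(i < rdim A l h') W w (Wmid l h'.+1) j i * g i *
            (if k == Wmid l h'.+1 then Q.1 i else Q.2 i))
  end.

Fixpoint rn_ps (R : realType) (A : resnet_arch) (alpha : nat -> R) (w : weights R)
    (x : nat -> R) (k : wid) (l : nat) : (nat -> R) * (nat -> R) :=
  match l with
  | 0 =>
      let P := fun j => isq R (rn_n0 A) * \sum_(i < rn_n0 A) W w Win j i * x i in
      (P, fun j => if k == Win then P j else 0)
  | l'.+1 =>
      let P := rn_ps A alpha w x k l' in
      let V := rn_psbranch A w l'.+1 (rn_y A alpha w x 0 l') P.1 P.2 k (rn_mb A) in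
      (fun j => P.1 j + Num.sqrt (alpha l'.+1) * V.1 j,
       fun j => P.2 j + Num.sqrt (alpha l'.+1) * V.2 j)
  end.

(* f_k(x;w) = sum over paths using a weight of W^k *)
Definition rn_fk (R : realType) (A : resnet_arch) (alpha : nat -> R) (w : weights R)
    (x : nat -> R) (k : wid) : R :=
  let P := rn_ps A alpha w x k (rn_L A) in
  isq R (rn_n A) * \sum_(j < rn_n A) W w Wout 0 j *
     (if k == Wout then P.1 j else P.2 j).

Definition rn_keys (A : resnet_arch) : seq wkey :=
  mat_keys Win (rn_n A) (rn_n0 A)
  ++ flatten [seq flatten [seq mat_keys (Wmid l h) (rdim A l h) (rdim A l h.-1)
                          | h <- iota 1 (rn_mb A)] | l <- iota 1 (rn_L A)]
  ++ mat_keys Wout 1 (rn_n A).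

Definition rn_valid (A : resnet_arch) (k : wid) : bool :=
  match k with
  | Wmid l h => (1 <= l <= rn_L A)%N && (1 <= h <= rn_mb A)%N
  | _ => true
  end.

(* n0 = input dimension, L = depth, n l = dimension n_l of y^l (0 <= l <= L) *)
Record densenet_arch := DenseNetArch { dn_n0 : nat; dn_L : nat; dn_n : nat -> nat }.

(* which connections W^{l,h} are kept: drop = Some (lk,hk) is the reduced
   network for W^{lk,hk} *)
Definition dn_conn (drop : option (nat * nat)) (l h : nat) : bool :=
  match drop with
  | None => true
  | Some (lk, hk) => if l == lk then h == hk else if (lk < l)%N then (lk <= h)%N else true
  end.

Definition dn_y0 (R : realType) (D : densenet_arch) (w : weights R) (x : nat -> R)
    : nat -> R :=
  fun j => isq R (dn_n0 D) * \sum_(i < dn_n0 D) W w Win j i * x i.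

Definition dn_scale (R : realType) (D : densenet_arch) (alpha : R) (l : nat) : R :=
  Num.sqrt (alpha / ((dn_n D l.-1)%:R * l%:R)).

(* table h j |-> y^h_j for h <= l *)
Fixpoint dn_tab (R : realType) (D : densenet_arch) (alpha : R) (w : weights R)
    (x : nat -> R) (drop : option (nat * nat)) (l : nat) : nat -> nat -> R :=
  match l with
  | 0 => fun _ j => dn_y0 D w x j
  | l'.+1 =>
      let T := dn_tab D alpha w x drop l' in
      let new := fun j => dn_scale D alpha l'.+1 *
         \sum_(h < l'.+1 | dn_conn drop l'.+1 h)
            \sum_(i < dn_n D h) W w (Wmid l'.+1 h) j i * (sq2 R * relu (T h i)) in
      fun h j => if (h <= l')%N then T h j else new j
  end.

Definition dn_out (R : realType) (D : densenet_arch) (alpha : R) (w : weights R)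
    (x : nat -> R) (drop : option (nat * nat)) : R :=
  isq R (dn_n D (dn_L D)) *
  \sum_(j < dn_n D (dn_L D)) W w Wout 0 j * dn_tab D alpha w x drop (dn_L D) (dn_L D) j.

Definition dn_f (R : realType) D (alpha : R) w x := dn_out D alpha w x None.

Definition dn_reduced (R : realType) D (alpha : R) (w : weights R) x (k : wid) : R :=
  match k with
  | Wmid l h => dn_out D alpha w x (Some (l, h))
  | _ => dn_out D alpha w x None
  end.

(* path sums (all paths / paths through W^k) to the neurons y^h_j, h <= l,
   split at the last edge; gates are those of f(x;w) *)
Fixpoint dn_ps (R : realType) (D : densenet_arch) (alpha : R) (w : weights R)
    (x : nat -> R) (k : wid) (l : nat) : (nat -> nat -> R) * (nat -> nat -> R) :=
  match l with
  | 0 => (fun _ j => dn_y0 D w x j, fun _ j => if k == Win then dn_y0 D w x j else 0)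
  | l'.+1 =>
      let T := dn_ps D alpha w x k l' in
      let Y := dn_tab D alpha w x None l' in
      let newA := fun j => dn_scale D alpha l'.+1 *
         \sum_(h < l'.+1) \sum_(i < dn_n D h)
            W w (Wmid l'.+1 h) j i * (sq2 R * gate (Y h i)) * T.1 h i in
      let newB := fun j => dn_scale D alpha l'.+1 *
         \sum_(h < l'.+1) \sum_(i < dn_n D h)
            W w (Wmid l'.+1 h) j i * (sq2 R * gate (Y h i)) *
              (if k == Wmid l'.+1 h then T.1 h i else T.2 h i) in
      (fun h j => if (h <= l')%N then T.1 h j else newA j,
       fun h j => if (h <= l')%N then T.2 h j else newB j)
  end.

Definition dn_fk (R : realType) (D : densenet_arch) (alpha : R) (w : weights R)
    (x : nat -> R) (k : wid) : R :=
  let T := dn_ps D alpha w x k (dn_L D) in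
  isq R (dn_n D (dn_L D)) * \sum_(j < dn_n D (dn_L D)) W w Wout 0 j *
     (if k == Wout then T.1 (dn_L D) j else T.2 (dn_L D) j).

Definition dn_keys (D : densenet_arch) : seq wkey :=
  mat_keys Win (dn_n D 0) (dn_n0 D)
  ++ flatten [seq flatten [seq mat_keys (Wmid l h) (dn_n D l) (dn_n D h)
                          | h <- iota 0 l] | l <- iota 1 (dn_L D)]
  ++ mat_keys Wout 1 (dn_n D (dn_L D)).

Definition dn_valid (D : densenet_arch) (k : wid) : bool :=
  match k with
  | Wmid l h => (1 <= l <= dn_L D)%N && (h < l)%N
  | _ => true
  end.

(* Main.v *)
(* Multiply every weight by the signs of the hidden neurons at its two ends.  This gauge
   transformation preserves the Gaussian law and, for fixed gates, the contribution of
   every path, while it multiplies the preactivation of a neuron by its own sign.  For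
   fixed weights the sign patterns therefore produce every gate pattern exactly once, so
   that averaging over the signs makes the gates free.  With free gates the reduced
   network is the sum over the paths through W^k, whether the actual gates were those of
   the reduced or of the full network: both moments equal the same average over free
   gates.  The exception is a neuron whose preactivation vanishes, which no sign can open;
   but then almost surely no active path reaches it, and its gate is irrelevant. *)
Require Import Defs.
From HB Require Import structures.
From mathcomp Require Import all_boot all_order all_algebra.
From mathcomp Require Import all_classical all_reals all_analysis.
From mathcomp Require Import measurable_realfun zify.
Set Implicit Arguments.
Unset Strict Implicit.
Unset Printing Implicit Defensive.
Import Order.TTheory GRing.Theory Num.Theory.
Local Open Scope ring_scope.

Lemma sume_const (R : realDomainType) (I : finType) (x : \bar R) :
  (\sum_(i : I) x = #|I|%:R%:E * x)%E.
Proof. by rewrite big_const -Monoid.iteropE mule_natl. Qed.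

Lemma sume_const_inj (R : realDomainType) (I : finType) : (0 < #|I|)%N ->
  injective (fun x : \bar R => \sum_(i : I) x)%E.
Proof.
move=> I_gt0 x y; rewrite !sume_const.
by apply: (inc_inj (lee_pmul2l _ _)); rewrite ?lte_fin ?ltr0n.
Qed.

Lemma signr_mul_gt0 (R : realDomainType) (b : bool) (t : R) : t != 0 ->
  (0 < (-1) ^+ b * t) = b (+) (0 < t).
Proof.
by case: b => t0; rewrite ?mul1r// mulN1r oppr_gt0 addTb -leNgt le_eqVlt (negbTE t0).
Qed.

Section network_primitives.
Context {R : realType}.
Implicit Types (t : R) (k : wid).

Lemma reluE t : relu t = if 0 < t then t else 0.
Proof. by rewrite /relu maxEle; case: ltgtP => // ->. Qed.

Lemma gate_mul t : gate t * t = relu t.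
Proof. by rewrite reluE /gate; case: ifP; rewrite ?mul1r ?mul0r. Qed.

Lemma sq2_neq0 : sq2 R != 0.
Proof. by rewrite gt_eqF// sqrtr_gt0. Qed.

Lemma isq_neq0 n : (0 < n)%N -> isq R n != 0.
Proof. by move=> n0; rewrite invr_neq0// gt_eqF// sqrtr_gt0 ltr0n. Qed.

Lemma unit_vector_dim_gt0 n (x : nat -> R) :
  Num.sqrt (\sum_(i < n) x i ^+ 2) = 1 -> (0 < n)%N.
Proof. by case: n => //; rewrite big_ord0 sqrtr0 => /esym/eqP; rewrite oner_eq0. Qed.

Lemma Wmid_eq l h l' h' : (Wmid l h == Wmid l' h') = (l == l') && (h == h').
Proof. by apply/eqP/andP => [[-> ->]//|[/eqP -> /eqP ->]]. Qed.

Lemma mem_mat_keys k r c j i :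
  (j < r)%N -> (i < c)%N -> (k, j, i) \in mat_keys k r c.
Proof. by move=> j_r i_c; apply: allpairs_f; rewrite mem_iota. Qed.

Definition is_projection k : bool := if k is Wmid _ _ then false else true.

Definition wid_upto l k : bool :=
  match k with Win => true | Wmid l' _ => (l' <= l)%N | Wout => false end.

Lemma wid_uptoS l k : wid_upto l k -> wid_upto l.+1 k.
Proof. by case: k => //= l' _; exact: leqW. Qed.

End network_primitives.

(** * The Gaussian law of the weights *)

Section centered_normal.
Context {R : realType} (s : R).
Hypothesis s_neq0 : s != 0.
Local Notation mu := (@lebesgue_measure R).
Local Notation opp := (-%R : _ -> measurableTypeR R).

Lemma normal_pdfN (x : R) : normal_pdf 0 s (- x) = normal_pdf 0 s x.
Proof. by rewrite !normal_pdfE// /normal_fun !subr0 sqrrN. Qed.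

Lemma normal_probN (A : set R) : measurable A ->
  pushforward (normal_prob 0 s) opp A = normal_prob 0 s A.
Proof.
move=> mA; rewrite /pushforward /normal_prob.
transitivity (\int[pushforward mu opp]_(x in A) (normal_pdf 0 s x)%:E)%E.
  rewrite ge0_integral_pushforward//.
  - by apply: eq_integral => x _ /=; rewrite normal_pdfN.
  - by apply/measurable_EFinP; apply: measurable_funS (measurable_normal_pdf _ _).
  - by move=> y _; rewrite lee_fin normal_pdf_ge0.
by apply: eq_measure_integral => B mB _; exact: lebesgue_measureN.
Qed.

Lemma ge0_integral_normal_probN (g : R -> \bar R) :
  measurable_fun setT g -> (forall t, 0 <= g t)%E ->
  (\int[normal_prob 0%R s]_t g (- t)%R = \int[normal_prob 0%R s]_t g t)%E.
Proof.
move=> mg g0.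
rewrite [RHS](@eq_measure_integral _ _ R setT (pushforward (normal_prob 0 s) opp)).
  by rewrite ge0_integral_pushforward.
by move=> A mA _; exact/esym/normal_probN.
Qed.

Lemma normal_prob_set1 (a : R) : normal_prob 0 s [set a] = 0%E.
Proof.
have /null_content_dominatesP := @normal_prob_dominates R 0 s.
by apply => //; exact: lebesgue_measure_set1.
Qed.

End centered_normal.

Section weights_sigma_algebra.
Context {R : realType}.
Local Open Scope classical_set_scope.

Definition weights_measurable : set (set (weights R)) :=
  <<s \bigcup_k preimage_set_system setT (fun w : weights R => w k) measurable >>.

Definition weights_display : measure_display. Proof. by constructor. Qed.

HB.instance Definition _ := gen_eqMixin (weights R).
HB.instance Definition _ := gen_choiceMixin (weights R).
HB.instance Definition _ := isPointed.Build (weights R) (fun=> 0).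

HB.instance Definition _ := @isMeasurable.Build weights_display (weights R)
  weights_measurable (@sigma_algebra0 _ _ _) (@sigma_algebraC _ _)
  (@sigma_algebra_bigcup _ _ _).

Lemma measurable_weight (k : wkey) : measurable_fun setT (fun w : weights R => w k).
Proof. by move=> _ A mA; apply: sub_sigma_algebra; exists k => //; exists A. Qed.

Lemma measurable_fun_weights d (T : measurableType d) (f : T -> weights R) :
  (forall k, measurable_fun setT (fun x => f x k)) -> measurable_fun setT f.
Proof.
move=> mf; apply: (measurability (\bigcup_k preimage_set_system setT
  (fun w : weights R => w k) measurable)) => // _ [_ [k _ [A mA <-]] <-].
by rewrite setTI; have := mf k measurableT A mA; rewrite setTI.
Qed.

Lemma measurable_upd d (T : measurableType d) (f : T -> weights R) k (t : T -> R) :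
  measurable_fun setT f -> measurable_fun setT t ->
  measurable_fun setT (fun x => upd (f x) k (t x)).
Proof.
move=> mf mt; apply: measurable_fun_weights => k'; rewrite /upd; case: (k' == k) => //.
exact: (measurableT_comp (measurable_weight k') mf).
Qed.

End weights_sigma_algebra.

Section weights_law.
Context {R : realType}.
Implicit Types (s : seq wkey) (k : wkey) (w : weights R) (G : weights R -> \bar R).
Local Notation N01 := (normal_prob (0 : R) 1).

Definition upd_pair k (tw : measurableTypeR R * weights R) : weights R := upd tw.2 k tw.1.

Lemma measurable_upd_pair k : measurable_fun setT (upd_pair k).
Proof. exact: measurable_upd. Qed.

HB.instance Definition _ k :=
  isMeasurableFun.Build _ _ _ _ (upd_pair k) (measurable_upd_pair k).

Fixpoint weights_law s : probability (weights R) R :=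
  if s is k :: s' then distribution (N01 \x weights_law s')%E (upd_pair k)
  else \d_((fun=> 0) : weights R).

Lemma measurable_fun_upd d (T : measurableType d) (G : weights R -> T) k t :
  measurable_fun setT G -> measurable_fun setT (fun w => G (upd w k t)).
Proof. by move=> mG; apply: (measurableT_comp mG); exact: measurable_upd. Qed.

Lemma measurable_fun_upd_pair G k :
  measurable_fun setT G -> measurable_fun setT (fun tw => G (upd_pair k tw)).
Proof. by move=> mG; exact: measurableT_comp. Qed.

Lemma ge0_integral_weights_law_cons k s G :
  measurable_fun setT G -> (forall w, 0 <= G w)%E ->
  (\int[weights_law (k :: s)]_w G w =
   \int[N01]_t \int[weights_law s]_w G (upd w k t))%E.
Proof.
move=> mG G0; rewrite ge0_integral_distribution// fubini_tonelli1//=.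
exact: measurable_fun_upd_pair.
Qed.

Lemma gexpE s G : measurable_fun setT G -> (forall w, 0 <= G w)%E ->
  gexp s G = (\int[weights_law s]_w G w)%E.
Proof.
elim: s G => [|k s IHs] G mG G0; first by rewrite integral_dirac// diracT mul1e.
rewrite ge0_integral_weights_law_cons//=; apply: eq_integral => t _.
by rewrite IHs//; exact: measurable_fun_upd.
Qed.

Lemma EmomE s (F : weights R -> R) m : measurable_fun setT F -> ~~ odd m ->
  Emom s F m = (\int[weights_law s]_w (F w ^+ m)%:E)%E.
Proof.
move=> mF m_even; rewrite /Emom gexpE// => [|w]; last by rewrite lee_fin exprn_even_ge0.
by apply/measurable_EFinP; exact: measurable_funX.
Qed.

Lemma upd_comm w k k' t t' : k != k' ->
  upd (upd w k t) k' t' = upd (upd w k' t') k t.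
Proof.
move=> kk'; apply/funext => x; rewrite /upd.
by have [->|//] := eqVneq x k'; rewrite eq_sym (negbTE kk').
Qed.

Lemma upd_upd w k t t' : upd (upd w k t) k t' = upd w k t'.
Proof. by apply/funext => x; rewrite /upd; case: (x == k). Qed.

Lemma ge0_integral_weights_law_resample k s G : k \in s ->
  measurable_fun setT G -> (forall w, 0 <= G w)%E ->
  (\int[weights_law s]_w G w =
   \int[weights_law s]_w \int[N01]_t G (upd w k t))%E.
Proof.
elim: s G => // k1 s IHs G + mG G0.
have mupd := measurable_fun_upd_pair k mG.
have mint : measurable_fun setT (fun w => \int[N01]_t G (upd w k t))%E.
  by apply: (measurable_fun_fubini_tonelli_G (m1 := N01) _ mupd) => tw.
have int_ge0 w : (0 <= \int[N01]_t G (upd w k t))%E by exact: integral_ge0.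
rewrite (ge0_integral_weights_law_cons _ _ mG G0).
rewrite (ge0_integral_weights_law_cons _ _ mint int_ge0) inE.
have [<- _|kk1 /= ks] := eqVneq k k1.
  rewrite (fubini_tonelli _ mupd); last by move=> tw.
  under [RHS]eq_integral do under eq_integral do under eq_integral do rewrite upd_upd.
  by rewrite integral_cst// [X in (_ * X)%E]probability_setT mule1.
apply: eq_integral => t1 _.
rewrite (IHs _ ks (measurable_fun_upd k1 t1 mG)); last by move=> w.
apply: eq_integral => w _; apply: eq_integral => t _; congr G; exact: upd_comm.
Qed.

Definition flip_signs (b : wkey -> bool) w : weights R := fun k => (-1) ^+ b k * w k.

Lemma measurable_flip_signs b : measurable_fun setT (flip_signs b).
Proof.
apply: measurable_fun_weights => k; apply: measurable_funM => //.
exact: measurable_weight.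
Qed.

Lemma measurable_fun_flip_signs b G :
  measurable_fun setT G -> measurable_fun setT (fun w => G (flip_signs b w)).
Proof.
by move=> mG; apply: measurableT_comp => //; exact: measurable_flip_signs.
Qed.

Lemma flip_signs_upd b w k t :
  flip_signs b (upd w k t) = upd (flip_signs b w) k ((-1) ^+ b k * t).
Proof. by apply/funext => k'; rewrite /flip_signs /upd; case: eqVneq => // ->. Qed.

Lemma ge0_integral_flip_signs b s G :
  measurable_fun setT G -> (forall w, 0 <= G w)%E ->
  (\int[weights_law s]_w G (flip_signs b w) = \int[weights_law s]_w G w)%E.
Proof.
elim: s G => [|k s IHs] G mG G0.
  have mGb := measurable_fun_flip_signs b mG.
  rewrite !integral_dirac//= !diracT !mul1e; congr G.
  by apply/funext => k; rewrite /flip_signs mulr0.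
rewrite (ge0_integral_weights_law_cons _ _ mG G0).
rewrite (ge0_integral_weights_law_cons _ _ (measurable_fun_flip_signs b mG) _)//.
transitivity (\int[N01]_t \int[weights_law s]_w G (upd w k ((-1) ^+ b k * t)))%E.
  apply: eq_integral => t _; under eq_integral do rewrite flip_signs_upd.
  by rewrite (IHs _ (measurable_fun_upd k _ mG)).
case: (b k); last by under eq_integral do rewrite mul1r.
under eq_integral do rewrite mulN1r.
apply: (ge0_integral_normal_probN _
  (g := fun t => \int[weights_law s]_w G (upd w k t))%E).
- exact: oner_neq0.
- exact: (measurable_fun_fubini_tonelli_F (m2 := weights_law s) _
    (measurable_fun_upd_pair k mG)).
- by move=> t; exact: integral_ge0.
Qed.

Definition invariant_at k U (f : weights R -> U) := forall w t, f (upd w k t) = f w.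

Lemma ae_affine_slope_eq0 s k (a b : weights R -> R) : k \in s ->
  measurable_fun setT a -> measurable_fun setT b ->
  invariant_at k a -> invariant_at k b ->
  {ae weights_law s, forall w, a w + w k * b w = 0 -> b w = 0}.
Proof.
move=> ks ma mb a_inv b_inv.
pose f w := a w + w k * b w.
have mf : measurable_fun setT f.
  by apply: measurable_funD => //; apply: measurable_funM => //; exact: measurable_weight.
pose Z := (f @^-1` [set 0] `\` b @^-1` [set 0])%classic.
have mZ : measurable Z.
  by apply: measurableD; rewrite -[X in measurable X]setTI; [exact: mf|exact: mb].
exists Z; split=> // [|w /= /not_implyP[]]; last by [].
rewrite -[Z]setIT -integral_indic// (ge0_integral_weights_law_resample ks)//; last first.
  exact/measurable_EFinP/measurable_indic.
apply: integral0_eq => w _; have [bw0|bw_neq0] := eqVneq (b w) 0.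
  apply: integral0_eq => t _; rewrite indicE memNset//= => -[_].
  by rewrite /preimage /= b_inv bw0; exact.
rewrite -(normal_prob_set1 1 (- a w / b w)) -[X in normal_prob _ _ X]setIT.
rewrite -integral_indic//.
apply: eq_integral => t _; congr (_%:E); rewrite !indicE; congr (nat_of_bool _)%:R.
have fE : f (upd w k t) = a w + t * b w by rewrite /f a_inv b_inv /upd eqxx.
apply/idP/idP; rewrite !inE /= -[Z _]/(f _ = 0 /\ b _ <> 0) fE b_inv.
  by move=> [/eqP + _]; rewrite addrC addr_eq0 => /eqP <-; rewrite mulfK.
by move=> ->; rewrite divfK ?subrr//; split=> //; exact/eqP.
Qed.

End weights_law.

(** * Circuits *)

Section circuit.
Variables (R : realType) (C : Type).

(* [Row k j n f] is the inner product of the first [n] entries of row [j] of the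
   matrix [k] with [f]; [Conn] marks the connections that a subnetwork may drop. *)
Inductive circuit :=
  | Const of R
  | Row of wid & nat & nat & (nat -> circuit)
  | Scale of R & circuit
  | Conn of C & circuit
  | Sum of nat & (nat -> circuit)
  | Relu of circuit.

HB.instance Definition _ := gen_eqMixin circuit.
HB.instance Definition _ := gen_choiceMixin circuit.

Definition Add (c c' : circuit) := Sum 2 (fun i => if i == 0%N then c else c').

(* A neuron is identified with the circuit computing its preactivation. *)
Fixpoint neurons (c : circuit) : seq circuit :=
  match c with
  | Const _ => [::]
  | Row _ _ n f | Sum n f => flatten [seq neurons (f i) | i <- iota 0 n]
  | Scale _ c | Conn _ c => neurons c
  | Relu c => c :: neurons c
  end.

Fixpoint ceval (act : circuit -> R -> R) (K : C -> bool) (w : weights R)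
    (c : circuit) : R :=
  match c with
  | Const a => a
  | Row k j n f => \sum_(i < n) W w k j i * ceval act K w (f i)
  | Scale a c => a * ceval act K w c
  | Conn x c => if K x then ceval act K w c else 0
  | Sum n f => \sum_(i < n) ceval act K w (f i)
  | Relu c => act c (ceval act K w c)
  end.

Definition relu_act (u : circuit) : R -> R := @relu R.

Definition gate_act (z : circuit -> bool) (u : circuit) (t : R) : R :=
  if z u then t else 0.

Definition open_gates K w (u : circuit) : bool := 0 < ceval relu_act K w u.

End circuit.
Arguments Const {R C}.
Arguments relu_act {R C} u.

Notation relu_value := (ceval relu_act).
Notation gated_value z := (ceval (gate_act z)).

(* The sum over the paths of [c] all of whose connections are in [K] and all of whose
   ReLUs are active in the network with connections [K']. *)
Notation path_sum K' K w c := (gated_value (open_gates K' w) K w c).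

Section circuit_theory.
Context {R : realType} {C : Type}.
Implicit Types (act : circuit R C -> R -> R) (K : C -> bool) (w : weights R).
Implicit Types (c u : circuit R C) (z : circuit R C -> bool).

Lemma neurons_branchP n (f : nat -> circuit R C) u :
  reflect (exists2 i, (i < n)%N & u \in neurons (f i)) (u \in neurons (Sum n f)).
Proof.
by apply: (iffP flatten_mapP) => -[i i_n uf]; exists i => //; move: i_n;
  rewrite mem_iota.
Qed.

Lemma neurons_ind c (P : circuit R C -> Prop) :
  {in neurons c, forall u, {in neurons u, forall v, P v} -> P u} ->
  {in neurons c, forall u, P u}.
Proof.
elim: c => /= [//|k j n f IHf|//|//|n f IHf|c IHc] Pind u.
- move=> /neurons_branchP[i i_n]; apply: IHf => v vf; apply: Pind.
  by apply/neurons_branchP; exists i.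
- move=> /neurons_branchP[i i_n]; apply: IHf => v vf; apply: Pind.
  by apply/neurons_branchP; exists i.
- have Pc : {in neurons c, forall u, P u}.
    by apply: IHc => v vc; apply: Pind; rewrite inE vc orbT.
  by rewrite inE => /predU1P[->|]; [apply: Pind; rewrite ?mem_head|exact: Pc].
Qed.

Lemma neurons_trans c : {in neurons c, forall u, {subset neurons u <= neurons c}}.
Proof.
elim: c => /= [//|k j n f IHf|//|//|n f IHf|c IHc] u.
- move=> /neurons_branchP[i i_n uf] v /(IHf i u uf) vf.
  by apply/neurons_branchP; exists i.
- move=> /neurons_branchP[i i_n uf] v /(IHf i u uf) vf.
  by apply/neurons_branchP; exists i.
- by rewrite inE => /predU1P[-> v vc|uc v /(IHc u uc) vc]; rewrite inE vc orbT.
Qed.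

Lemma eq_ceval act act' K w c :
  {in neurons c, forall u, act u (ceval act' K w u) = act' u (ceval act' K w u)} ->
  ceval act K w c = ceval act' K w c.
Proof.
elim: c => //= [k j n f IHf|a c IHc|x c IHc|n f IHf|c IHc] eq_act.
- apply: eq_bigr => i _; rewrite IHf// => u uf; apply: eq_act.
  by apply/neurons_branchP; exists (i : nat).
- by rewrite IHc.
- by rewrite IHc.
- apply: eq_bigr => i _; rewrite IHf// => u uf; apply: eq_act.
  by apply/neurons_branchP; exists (i : nat).
- by rewrite IHc ?eq_act ?mem_head// => u uc; rewrite eq_act// inE uc orbT.
Qed.

Lemma cevalD act K w c c' :
  ceval act K w (Add c c') = ceval act K w c + ceval act K w c'.
Proof. by rewrite /= !big_ord_recl big_ord0 addr0. Qed.

Lemma path_sum_self K w c : path_sum K K w c = relu_value K w c.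
Proof. by apply: eq_ceval => u _; rewrite /relu_act reluE. Qed.

Lemma gate_act_open_gates K w u t :
  gate_act (open_gates K w) u t = gate (relu_value K w u) * t.
Proof.
by rewrite /gate_act /open_gates /gate; case: ifP; rewrite ?mul1r ?mul0r.
Qed.

Lemma measurable_ceval (act : weights R -> circuit R C -> R -> R) K c :
  (forall u g, measurable_fun setT g -> measurable_fun setT (fun w => act w u (g w))) ->
  measurable_fun setT (fun w => ceval (act w) K w c).
Proof.
move=> mact; elim: c => //= [k j n f IHf|a c IHc|x c IHc|n f IHf|c IHc].
- apply: measurable_sum => i; apply: measurable_funM => //.
  exact: measurable_weight.
- exact: measurable_funM.
- by case: (K x).
- by apply: measurable_sum => i.
- exact: mact.
Qed.

Lemma measurable_relu_value K c : measurable_fun setT (fun w => relu_value K w c).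
Proof.
by apply: (@measurable_ceval (fun=> relu_act)) => u g mg; exact: measurable_maxr.
Qed.

Lemma measurable_gated_value z K c : measurable_fun setT (fun w => gated_value z K w c).
Proof.
apply: (@measurable_ceval (fun=> gate_act z)) => u g mg.
by rewrite /gate_act; case: (z u).
Qed.

Lemma measurable_path_sum K' K c : measurable_fun setT (fun w => path_sum K' K w c).
Proof.
apply: (@measurable_ceval (fun w => gate_act (open_gates K' w))) => u g mg.
apply: measurable_fun_ifT => //; apply: measurable_fun_ltr => //.
exact: measurable_relu_value.
Qed.

End circuit_theory.

(** * Gauge signs and gate patterns *)

Section gauge.
Context {R : realType} {C : Type}.
Variables (target source : wid -> nat -> option (circuit R C)).
Implicit Types (c u : circuit R C) (e z : circuit R C -> bool).

(* [target k j] and [source k i] are the neurons, if any, at the two ends of the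
   entry [(j, i)] of the matrix [k]; [oriented o c] says that the rows occurring in
   [c] agree with them and that the value of [c] belongs to [o]. *)
Fixpoint oriented (o : option (circuit R C)) c : Prop :=
  match c with
  | Const _ => o = None
  | Row k j n f =>
      target k j = o /\ forall i, (i < n)%N -> oriented (source k i) (f i)
  | Scale _ c | Conn _ c => oriented o c
  | Sum n f => forall i, (i < n)%N -> oriented o (f i)
  | Relu c => o = Some c /\ oriented o c
  end.

Lemma oriented_neurons o c : oriented o c ->
  {in neurons c, forall u, oriented (Some u) u}.
Proof.
elim: c o => /= [//|k j n f IHf o [_ o_f]|//|//|n f IHf o o_f|c IHc o [-> oc]] u.
- by move=> /neurons_branchP[i i_n]; exact: IHf (o_f i i_n) u.
- by move=> /neurons_branchP[i i_n]; exact: IHf (o_f i i_n) u.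
- by rewrite inE => /predU1P[->//|]; exact: IHc oc u.
Qed.

Definition node_sign e (o : option (circuit R C)) : R := (-1) ^+ oapp e false o.

Definition gauge e (k : wkey) : bool :=
  oapp e false (target k.1.1 k.1.2) (+) oapp e false (source k.1.1 k.2).

Lemma node_signK e o : involutive ( *%R (node_sign e o)).
Proof. by move=> t; rewrite mulrA -signr_addb addbb mul1r. Qed.

Lemma gated_value_gauge e z K w o c : oriented o c ->
  gated_value z K (flip_signs (gauge e) w) c = node_sign e o * gated_value z K w c.
Proof.
elim: c o => /= [a|k j n f IHf|a c IHc|x c IHc|n f IHf|c IHc] o.
- by move=> ->; rewrite mul1r.
- move=> [target_o o_f]; rewrite mulr_sumr; apply: eq_bigr => i _.
  rewrite (IHf _ _ (o_f _ (ltn_ord i))) /W {1}/flip_signs /gauge /= target_o.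
  rewrite signr_addb -/(node_sign e o) -/(node_sign e _) -!mulrA [w _ * _]mulrCA.
  by rewrite node_signK.
- by move=> oc; rewrite (IHc o)// mulrCA.
- by move=> oc; case: ifP; rewrite ?mulr0// (IHc o).
- move=> o_f; rewrite mulr_sumr; apply: eq_bigr => i _.
  exact: IHf (o_f _ (ltn_ord i)).
- by move=> [_ oc]; rewrite (IHc o)// /gate_act; case: ifP; rewrite ?mulr0.
Qed.

End gauge.

Section gate_patterns.
Context {R : realType} {C : Type}.
Implicit Types (c u : circuit R C).

Definition gate_pattern c := {ffun seq_sub (neurons c) -> bool}.

Definition pattern_gates c (z : gate_pattern c) u : bool := oapp z false (insub u).

Lemma pattern_gates_val c (z : gate_pattern c) (u : seq_sub (neurons c)) :
  pattern_gates z (val u) = z u.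
Proof. by rewrite /pattern_gates valK. Qed.

Variables (K K' : C -> bool) (w : weights R) (c : circuit R C).
Variable gates_of_signs : gate_pattern c -> circuit R C -> bool.
Local Notation Z := gates_of_signs.
Local Notation preact z u := (gated_value z K' w u).
Hypothesis gates_of_signsE : forall e, {in neurons c, forall u,
  Z e u = (0 < (-1) ^+ pattern_gates e u * preact (Z e) u)}.
Hypothesis preact_eq0 : forall z : gate_pattern c, {in neurons c, forall u,
  preact (pattern_gates z) u = 0 -> gated_value (pattern_gates z) K w u = 0}.

(* These signs open exactly the gates in [z], except at the neurons whose
   preactivation vanishes, where no sign matters. *)
Definition signs_of_gates (z : gate_pattern c) : gate_pattern c :=
  [ffun u => z u (+) (0 < preact (pattern_gates z) (val u))].

Lemma signs_of_gates_inj : injective signs_of_gates.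
Proof.
move=> z z' /ffunP eq_signs.
suff eqz : {in neurons c, forall u, pattern_gates z u = pattern_gates z' u}.
  by apply/ffunP => u; rewrite -!pattern_gates_val eqz ?ssvalP.
apply: neurons_ind => u uc eq_below.
have eq_preact : preact (pattern_gates z) u = preact (pattern_gates z') u.
  by apply: eq_ceval => v vu; rewrite /gate_act eq_below.
have := eq_signs (SeqSub uc); rewrite !ffunE -!pattern_gates_val /=.
by rewrite eq_preact => /addIb.
Qed.

Let gates_of_signs_of_gates (z : gate_pattern c) u : u \in neurons c ->
  preact (Z (signs_of_gates z)) u = preact (pattern_gates z) u ->
  preact (pattern_gates z) u != 0 -> Z (signs_of_gates z) u = pattern_gates z u.
Proof.
move=> uc eq_preact preact_neq0; rewrite gates_of_signsE// eq_preact signr_mul_gt0//.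
by rewrite -[u]/(val (SeqSub uc)) !pattern_gates_val ffunE addbK.
Qed.

Let preact_signs_of_gates (z : gate_pattern c) : {in neurons c, forall u,
  preact (Z (signs_of_gates z)) u = preact (pattern_gates z) u}.
Proof.
apply: neurons_ind => u uc eq_below; apply: eq_ceval => v vu.
have [v0|v_neq0] := eqVneq (preact (pattern_gates z) v) 0.
  by rewrite /gate_act v0 !if_same.
by rewrite /gate_act gates_of_signs_of_gates ?eq_below ?(neurons_trans uc).
Qed.

Lemma gated_value_signs_of_gates (z : gate_pattern c) :
  gated_value (Z (signs_of_gates z)) K w c = gated_value (pattern_gates z) K w c.
Proof.
apply: eq_ceval => u uc; have [u0|u_neq0] := eqVneq (preact (pattern_gates z) u) 0.
  by rewrite /gate_act preact_eq0// !if_same.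
by rewrite /gate_act gates_of_signs_of_gates ?preact_signs_of_gates.
Qed.

Lemma sum_signs_gates (F : R -> \bar R) :
  (\sum_(e : gate_pattern c) F (gated_value (Z e) K w c) =
   \sum_(z : gate_pattern c) F (gated_value (pattern_gates z) K w c))%E.
Proof.
rewrite (reindex_inj signs_of_gates_inj); apply: eq_bigr => z _.
by rewrite gated_value_signs_of_gates.
Qed.

End gate_patterns.

(** * Generic circuits *)

Section generic.
Context {R : realType} {C : Type}.
Implicit Types (c : circuit R C) (s : seq wkey) (z : circuit R C -> bool).

Fixpoint uses (k : wid) c : Prop :=
  match c with
  | Const _ => False
  | Row k' _ n f => k = k' \/ exists2 i, (i < n)%N & uses k (f i)
  | Scale _ c | Conn _ c | Relu c => uses k c
  | Sum n f => exists2 i, (i < n)%N & uses k (f i)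
  end.

Fixpoint top_uses (k : wid) c : Prop :=
  match c with
  | Const _ => False
  | Row k' _ _ _ => k = k'
  | Scale _ c | Conn _ c | Relu c => top_uses k c
  | Sum n f => exists2 i, (i < n)%N & top_uses k (f i)
  end.

Fixpoint weighted c : Prop :=
  match c with
  | Const _ => False
  | Row _ _ _ _ => True
  | Scale _ c | Conn _ c | Relu c => weighted c
  | Sum n f => forall i, (i < n)%N -> weighted (f i)
  end.

(* The freshness conditions make distinct paths carry distinct monomials in the
   weights, so that for fixed gates the value of a generic circuit vanishes only with
   probability zero unless no active path of nonzero coefficient is left. *)
Fixpoint generic s c : Prop :=
  match c with
  | Const _ => True
  | Row k j n f => forall i, (i < n)%N ->
      [/\ (k, j, i) \in s, ~ uses k (f i) & generic s (f i)]
  | Scale a c => a != 0 /\ generic s c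
  | Conn _ c | Relu c => generic s c
  | Sum n f => forall i, (i < n)%N ->
      [/\ weighted (f i),
          forall k i', (i' < i)%N -> top_uses k (f i) -> ~ uses k (f i') &
          generic s (f i)]
  end.

Lemma generic_neurons s c : generic s c -> {in neurons c, forall u, generic s u}.
Proof.
elim: c => //= [k j n f IHf gen|a c IHc [_ gen]|n f IHf gen|c IHc gen] u.
- by move=> /neurons_branchP[i i_n]; have [_ _ geni] := gen i i_n; exact: IHf geni u.
- exact: IHc.
- by move=> /neurons_branchP[i i_n]; have [_ _ geni] := gen i i_n; exact: IHf geni u.
- by rewrite inE => /predU1P[->//|]; exact: IHc.
Qed.

Lemma invariant_gated_value z K k j i c : ~ uses k c ->
  invariant_at (k, j, i) (fun w : weights R => gated_value z K w c).
Proof.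
elim: c => //= [k' j' n f IHf kf|a c IHc kc|x c IHc kc|n f IHf kf|c IHc kc] w t.
- apply: eq_bigr => i' _; rewrite IHf; last first.
    by move=> kfi; apply: kf; right; exists (i' : nat).
  rewrite /W /upd !xpair_eqE; case: (k' =P k) => [kk'|//].
  by case: kf; left.
- by rewrite IHc.
- by rewrite IHc.
- apply: eq_bigr => i' _; rewrite IHf// => kfi; apply: kf.
  by exists (i' : nat).
- by rewrite IHc.
Qed.

Variables (s : seq wkey) (z : circuit R C -> bool).
Implicit Types (K : C -> bool) (r : weights R -> R).

Definition separable K c := forall r, measurable_fun setT r ->
  (forall k j i, top_uses k c -> invariant_at (k, j, i) r) ->
  {ae weights_law s, forall w, r w + gated_value z K w c = 0 -> gated_value z K w c = 0}.

Lemma ae_Row_eq0 K k j n f r : generic s (Row k j n f) ->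
  measurable_fun setT r -> (forall i, invariant_at (k, j, i) r) ->
  {ae weights_law s, forall w, r w + gated_value z K w (Row k j n f) = 0 ->
    forall i : 'I_n, gated_value z K w (f i) = 0}.
Proof.
move=> gen mr r_inv.
suff : {ae weights_law s, forall w, forall i : 'I_n,
    r w + gated_value z K w (Row k j n f) = 0 -> gated_value z K w (f i) = 0}.
  by apply: filterS => w f0 row0 i; exact: f0.
apply: filter_forall => i; have [kji_s kfi _] := gen i (ltn_ord i).
pose rest w := r w + \sum_(i' < n | i' != i) W w k j i' * gated_value z K w (f i').
have mrest : measurable_fun setT rest.
  apply: measurable_funD => //; under eq_fun do rewrite -big_filter.
  apply: measurable_sum => i'; apply: measurable_funM; first exact: measurable_weight.
  exact: measurable_gated_value.
have rest_inv : invariant_at (k, j, i : nat) rest.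
  move=> w t; rewrite /rest r_inv; congr (_ + _); apply: eq_bigr => i' i'i.
  have [_ kfi' _] := gen i' (ltn_ord i').
  rewrite (invariant_gated_value _ _ _ _ kfi'); congr (_ * _).
  by rewrite /W /upd !xpair_eqE !eqxx /= val_eqE (negbTE i'i).
have := ae_affine_slope_eq0 kji_s mrest (measurable_gated_value z K (f i)) rest_inv
  (invariant_gated_value _ _ _ _ kfi).
apply: filterS => w + row0; apply.
by rewrite -[RHS]row0 /= [in RHS](bigD1 i)//= -addrA; congr (_ + _); exact: addrC.
Qed.

Lemma ae_Sum_eq0 K n f r : generic s (Sum n f) ->
  (forall i, (i < n)%N -> separable K (f i)) -> measurable_fun setT r ->
  (forall k j i, top_uses k (Sum n f) -> invariant_at (k, j, i) r) ->
  {ae weights_law s, forall w, r w + gated_value z K w (Sum n f) = 0 ->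
    forall i, (i < n)%N -> gated_value z K w (f i) = 0}.
Proof.
elim: n => [|n IHn] gen sep mr r_inv; first exact: aeW.
pose init w := r w + gated_value z K w (Sum n f).
have minit : measurable_fun setT init.
  by apply: measurable_funD => //; exact: measurable_gated_value.
have init_inv k j i : top_uses k (f n) -> invariant_at (k, j, i) init.
  move=> kfn w t; rewrite /init r_inv; last by exists n.
  congr (_ + _); apply: invariant_gated_value => -[i' i'_n].
  by have [_ disj _] := gen n (ltnSn n); exact: disj.
have init_eq0 : {ae weights_law s, forall w, init w = 0 ->
    forall i, (i < n)%N -> gated_value z K w (f i) = 0}.
  apply: IHn => // [i i_n|i i_n|k j i [i' i'_n kfi']].
  - by apply: gen; exact: ltnW.
  - by apply: sep; exact: ltnW.
  - by apply: r_inv; exists i' => //; exact: ltnW.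
apply: filterS2 init_eq0 (sep n (ltnSn n) init minit init_inv) => w init0 last0.
rewrite /= big_ord_recr /= addrA -/(gated_value z K w (Sum n f)) -/(init w) => sum0.
have fn0 := last0 sum0; move: sum0; rewrite fn0 addr0 => /init0 {}init0 i.
by rewrite ltnS leq_eqVlt => /predU1P[->//|]; exact: init0.
Qed.

Lemma generic_separable K c : generic s c -> weighted c -> separable K c.
Proof.
elim: c => [//|k j n f IHf gen _|a c IHc [a0 gen] wc|x c IHc gen wc
  |n f IHf gen wf|c IHc gen wc] r mr r_inv.
- apply: filterS (ae_Row_eq0 K gen mr (fun i => r_inv k j i erefl)) => w f0 /f0{}f0.
  by rewrite /= big1// => i _; rewrite f0 mulr0.
- have mra : measurable_fun setT (fun w => a^-1 * r w) by exact: measurable_funM.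
  apply: filterS (IHc gen wc _ mra _) => [w /= c0 rc0|k j i kc w t].
    rewrite c0 ?mulr0//; apply: (mulfI a0).
    by rewrite mulrDr mulVKf// mulr0.
  by rewrite r_inv.
- by rewrite /=; case: (K x); [exact: IHc|exact: aeW].
- have sep i : (i < n)%N -> separable K (f i).
    by move=> i_n; have [_ _ geni] := gen i i_n; exact: IHf geni (wf i i_n).
  apply: filterS (ae_Sum_eq0 gen sep mr r_inv) => w f0 /f0{}f0.
  by rewrite /= big1// => i _; exact: f0.
- by rewrite /= /gate_act; case: (z c); [exact: IHc|exact: aeW].
Qed.

Lemma ae_subcircuit_eq0 K K' c : (forall x, K x -> K' x) -> generic s c ->
  {ae weights_law s, forall w, gated_value z K' w c = 0 -> gated_value z K w c = 0}.
Proof.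
move=> subK; elim: c => [a _|k j n f IHf gen|a c IHc [a0 gen]|x c IHc gen
  |n f IHf gen|c IHc gen]; first exact: aeW.
- have f0 : {ae weights_law s, forall w, forall i : 'I_n,
      gated_value z K' w (f i) = 0 -> gated_value z K w (f i) = 0}.
    by apply: filter_forall => i; have [_ _] := gen i (ltn_ord i); exact: IHf.
  have row0 := ae_Row_eq0 K' gen (measurable_cst (0 : R)) (fun _ _ _ => erefl).
  apply: filterS2 f0 row0 => w f0 row0 rowK'.
  by rewrite /= big1// => i _; rewrite f0 ?mulr0//; apply: row0; rewrite add0r.
- apply: filterS (IHc gen) => w c0 /eqP; rewrite /= mulf_eq0 (negbTE a0) => /eqP /c0 ->.
  by rewrite mulr0.
- rewrite /=; case Kx: (K x); last exact: aeW.
  by rewrite (subK _ Kx); exact: IHc.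
- have f0 : {ae weights_law s, forall w, forall i : 'I_n,
      gated_value z K' w (f i) = 0 -> gated_value z K w (f i) = 0}.
    by apply: filter_forall => i; have [_ _] := gen i (ltn_ord i); exact: IHf.
  have sep i : (i < n)%N -> separable K' (f i).
    by move=> i_n; have [wfi _ geni] := gen i i_n; exact: generic_separable.
  have sum0 := ae_Sum_eq0 gen sep (measurable_cst (0 : R)) (fun _ _ _ _ _ _ => erefl).
  apply: filterS2 f0 sum0 => w f0 sum0 sumK'.
  by rewrite /= big1// => i _; apply: f0; apply: sum0; rewrite // add0r.
- by rewrite /= /gate_act; case: (z c); [exact: IHc|exact: aeW].
Qed.

End generic.

(** * Moments of subcircuits *)

Section moments.
Context {R : realType} {C : Type}.
Variables (target source : wid -> nat -> option (circuit R C)).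
Variables (s : seq wkey) (c : circuit R C) (K : C -> bool) (m : nat).
Hypothesis c_oriented : oriented target source None c.
Hypothesis c_generic : generic s c.
Hypothesis m_even : ~~ odd m.

Let flip (e : gate_pattern c) : weights R -> weights R :=
  flip_signs (gauge target source (pattern_gates e)).

Let power_ge0 (t : R) : (0 <= (t ^+ m)%:E)%E.
Proof. by rewrite lee_fin exprn_even_ge0. Qed.

Let measurable_power (g : weights R -> R) :
  measurable_fun setT g -> measurable_fun setT (fun w => (g w ^+ m)%:E).
Proof. by move=> mg; apply/measurable_EFinP; exact: measurable_funX. Qed.

Lemma sum_path_sum_flip (K' : C -> bool) w :
  (forall (z : gate_pattern c) (u : seq_sub (neurons c)),
     gated_value (pattern_gates z) K' w (val u) = 0 ->
     gated_value (pattern_gates z) K w (val u) = 0) ->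
  (\sum_(e : gate_pattern c) (path_sum K' K (flip e w) c ^+ m)%:E =
   \sum_(z : gate_pattern c) (gated_value (pattern_gates z) K w c ^+ m)%:E)%E.
Proof.
move=> preact_eq0.
rewrite -(@sum_signs_gates _ _ K K' w c (fun e => open_gates K' (flip e w))
  _ _ (fun t => (t ^+ m)%:E)).
- by apply: eq_bigr => e _; rewrite (gated_value_gauge _ _ _ _ c_oriented) mul1r.
- move=> e u uc; rewrite {1}/open_gates -path_sum_self.
  by rewrite (gated_value_gauge _ _ _ _ (oriented_neurons c_oriented uc)).
- by move=> z u uc; exact: (preact_eq0 z (SeqSub uc)).
Qed.

(* Averaging over the gauge signs replaces the actual gates by free ones, and the
   outcome no longer depends on [K']. *)
Lemma sum_Emom_path_sum (K' : C -> bool) : (forall x, K x -> K' x) ->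
  (\sum_(e : gate_pattern c) Emom s (fun w => path_sum K' K w c) m =
   \int[weights_law s]_w
     \sum_(z : gate_pattern c) (gated_value (pattern_gates z) K w c ^+ m)%:E)%E.
Proof.
move=> subK.
have mpath := measurable_power (measurable_path_sum K' K c).
have mflip (e : gate_pattern c) :
    measurable_fun setT (fun w => (path_sum K' K (flip e w) c ^+ m)%:E).
  exact: (measurable_fun_flip_signs _ mpath).
have mgated (z : gate_pattern c) :
    measurable_fun setT (fun w => (gated_value (pattern_gates z) K w c ^+ m)%:E).
  by apply: measurable_power; exact: measurable_gated_value.
transitivity (\int[weights_law s]_w
    \sum_(e : gate_pattern c) (path_sum K' K (flip e w) c ^+ m)%:E)%E.
  rewrite ge0_integral_sum//; apply: eq_bigr => e _.
  rewrite EmomE ?(ge0_integral_flip_signs _ _ mpath)//.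
  exact: measurable_path_sum.
apply: ge0_ae_eq_integral => //.
- exact: emeasurable_sum.
- exact: emeasurable_sum.
- by move=> w _; exact: sume_ge0.
- by move=> w _; exact: sume_ge0.
have preact_eq0 : {ae weights_law s, forall w,
    forall (z : gate_pattern c) (u : seq_sub (neurons c)),
    gated_value (pattern_gates z) K' w (val u) = 0 ->
    gated_value (pattern_gates z) K w (val u) = 0}.
  apply: filter_forall => z; apply: filter_forall => u.
  apply: ae_subcircuit_eq0 => //; apply: (generic_neurons c_generic).
  exact: ssvalP.
by apply: filterS preact_eq0 => w preact_eq0 _; exact: sum_path_sum_flip.
Qed.

Lemma Emom_relu_value_path_sum (K' : C -> bool) : (forall x, K x -> K' x) ->
  Emom s (fun w => relu_value K w c) m = Emom s (fun w => path_sum K' K w c) m.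
Proof.
move=> subK; under eq_fun do rewrite -path_sum_self.
apply: (@sume_const_inj R (gate_pattern c)).
  by apply/card_gt0P; exists [ffun=> false].
by rewrite !sum_Emom_path_sum.
Qed.

End moments.

(** * ResNets *)

Section resnet.
Context {R : realType} (A : resnet_arch) (alpha : nat -> R) (x : nat -> R).
Implicit Types (w : weights R) (k : wid) (yc : nat -> circuit R nat).

Fixpoint rn_branch_circuit l yc h : nat -> circuit R nat :=
  match h with
  | 0 => yc
  | h'.+1 => fun j => Scale (isq R (rdim A l h'))
      (Row (Wmid l h'.+1) j (rdim A l h') (fun i =>
         if h' == 0%N then rn_branch_circuit l yc h' i
         else Scale (sq2 R) (Relu (rn_branch_circuit l yc h' i))))
  end.
Local Notation branch := rn_branch_circuit.

Fixpoint rn_y_circuit l : nat -> circuit R nat :=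
  match l with
  | 0 => fun j => Scale (isq R (rn_n0 A))
      (Row Win j (rn_n0 A) (fun i => Const (x i)))
  | l'.+1 => fun j => Add (Conn l' (rn_y_circuit l' j))
      (Scale (Num.sqrt (alpha l'.+1)) (branch l'.+1 (rn_y_circuit l') (rn_mb A) j))
  end.
Local Notation y := rn_y_circuit.

Definition rn_out_circuit : circuit R nat :=
  Scale (isq R (rn_n A)) (Row Wout 0 (rn_n A) (y (rn_L A))).

(* The skip connection of block [l.+1] is labelled by [l], so that [drop = 0] keeps
   all of them. *)
Definition rn_kept (drop l : nat) : bool := l.+1 != drop.

Lemma relu_value_rn_branch K w l yc h j :
  relu_value K w (branch l yc h j) =
  rn_branch A w l (fun i => relu_value K w (yc i)) h j.
Proof.
elim: h j => //= h IHh j; congr (_ * _); apply: eq_bigr => i _; congr (_ * _).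
by case: eqVneq => _ /=; rewrite IHh.
Qed.

Lemma relu_value_rn_y drop w l :
  (fun j => relu_value (rn_kept drop) w (y l j)) = rn_y A alpha w x drop l.
Proof.
elim: l => [//|l IHl]; apply/funext => j.
rewrite [y _]/= cevalD /= relu_value_rn_branch IHl -IHl.
by congr (_ + _); rewrite /rn_kept; case: eqVneq.
Qed.

Lemma relu_value_rn_out drop w :
  relu_value (rn_kept drop) w rn_out_circuit = rn_out A alpha w x drop.
Proof. by rewrite /rn_out -relu_value_rn_y. Qed.

Lemma rn_psbranch1 w l yp PB k h :
  (rn_psbranch A w l yp yp PB k h).1 = rn_branch A w l yp h.
Proof.
elim: h => //= h IHh; apply/funext => j; congr (_ * _); apply: eq_bigr => i _.
rewrite IHh -mulrA; congr (_ * _).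
by case: (h == 0%N); rewrite ?mul1r// -mulrA gate_mul.
Qed.

Lemma rn_ps1 w k l : (rn_ps A alpha w x k l).1 = rn_y A alpha w x 0 l.
Proof. by elim: l => //= l IHl; apply/funext => j; rewrite IHl rn_psbranch1. Qed.

Lemma rn_psbranch2_id w l yp PA k h : (forall h', k != Wmid l h') ->
  (rn_psbranch A w l yp PA PA k h).2 = (rn_psbranch A w l yp PA PA k h).1.
Proof.
move=> kNl; elim: h => //= h IHh; apply/funext => j.
by under eq_bigr do rewrite (negbTE (kNl _)) IHh.
Qed.

Lemma rn_psbranch2_0 w l yp PA k h : (forall h', k != Wmid l h') ->
  (rn_psbranch A w l yp PA (fun=> 0) k h).2 = fun=> 0.
Proof.
move=> kNl; elim: h => //= h IHh; apply/funext => j.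
by under eq_bigr do rewrite (negbTE (kNl _)) IHh mulr0; rewrite big1_eq mulr0.
Qed.

Lemma rn_psbranch2_through w l yp PA PB hk h : (0 < hk <= h)%N ->
  (rn_psbranch A w l yp PA PB (Wmid l hk) h).2 =
  (rn_psbranch A w l yp PA PB (Wmid l hk) h).1.
Proof.
elim: h => [|h IHh] /andP[hk_gt0 hk_le]; first by move: hk_gt0 hk_le; lia.
apply/funext => j /=; congr (_ * _); apply: eq_bigr => i _; congr (_ * _).
have [->|hk_neq] := eqVneq hk h.+1; first by rewrite eqxx.
by rewrite IHh ?if_same// hk_gt0 -ltnS ltn_neqAle hk_neq.
Qed.

Lemma rn_psbranch2_path_sum K w l yc PA k h : (forall h', k != Wmid l h') ->
  (rn_psbranch A w l (fun i => relu_value (rn_kept 0) w (yc i)) PA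
    (fun i => path_sum (rn_kept 0) K w (yc i)) k h).2 =
  fun j => path_sum (rn_kept 0) K w (branch l yc h j).
Proof.
move=> kNl; elim: h => //= h IHh; apply/funext => j; congr (_ * _).
apply: eq_bigr => i _; rewrite (negbTE (kNl _)) IHh -mulrA; congr (_ * _).
case: (h == 0%N); first by rewrite mul1r.
by rewrite /= gate_act_open_gates relu_value_rn_branch mulrA.
Qed.

Lemma eq_ceval_rn_branch act K K' w l yc h j :
  (forall i, ceval act K w (yc i) = ceval act K' w (yc i)) ->
  ceval act K w (branch l yc h j) = ceval act K' w (branch l yc h j).
Proof.
move=> eq_yc; elim: h j => //= h IHh j; congr (_ * _); apply: eq_bigr => i _.
by case: (h == 0%N) => /=; rewrite IHh.
Qed.

Lemma ceval_rn_y_before act drop w l j : (l < drop)%N ->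
  ceval act (rn_kept drop) w (y l j) = ceval act (rn_kept 0) w (y l j).
Proof.
elim: l j => [//|l IHl] j l_drop.
have eq_y i := IHl i (ltnW l_drop).
rewrite [y _]/= !cevalD /= (eq_ceval_rn_branch _ _ _ eq_y) eq_y.
by rewrite /rn_kept ltn_eqF.
Qed.

Lemma rn_ps2_path_sum w lk hk l : (0 < lk)%N -> (0 < hk <= rn_mb A)%N ->
  (rn_ps A alpha w x (Wmid lk hk) l).2 =
  if (l < lk)%N then fun=> 0 else fun j => path_sum (rn_kept 0) (rn_kept lk) w (y l j).
Proof.
move=> lk_gt0 hk_mb; elim: l => [|l IHl]; first by rewrite lk_gt0.
apply/funext => j; have [l_lk|lk_l|lkE] := ltngtP l.+1 lk.
- rewrite /= IHl (ltnW l_lk) rn_psbranch2_0 ?mulr0 ?addr0// => h'.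
  by rewrite Wmid_eq gtn_eqF.
- rewrite [y _]/= cevalD /= IHl ltnNge -ltnS lk_l /= -relu_value_rn_y.
  rewrite rn_psbranch2_path_sum => [|h']; last by rewrite Wmid_eq ltn_eqF.
  by rewrite /rn_kept gtn_eqF.
- have eq_y i := ceval_rn_y_before (gate_act (open_gates (rn_kept 0) w)) w i (ltnSn l).
  rewrite [y _]/= cevalD /= IHl -lkE ltnSn rn_psbranch2_through// rn_ps1 rn_psbranch1.
  rewrite (eq_ceval_rn_branch _ _ _ eq_y) path_sum_self relu_value_rn_branch.
  by rewrite relu_value_rn_y /rn_kept eqxx.
Qed.

Lemma rn_fk_path_sum w lk hk : (0 < lk <= rn_L A)%N -> (0 < hk <= rn_mb A)%N ->
  rn_fk A alpha w x (Wmid lk hk) = path_sum (rn_kept 0) (rn_kept lk) w rn_out_circuit.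
Proof.
by move=> /andP[lk_gt0 lk_L] hk_mb; rewrite /rn_fk rn_ps2_path_sum// ltnNge lk_L.
Qed.

Lemma rn_ps2_Win w l : (rn_ps A alpha w x Win l).2 = (rn_ps A alpha w x Win l).1.
Proof.
by elim: l => //= l IHl; apply/funext => j; rewrite IHl rn_psbranch2_id.
Qed.

Lemma rn_fk_projection w k : is_projection k ->
  rn_fk A alpha w x k = rn_reduced A alpha w x k.
Proof. by case: k => // _; rewrite /rn_fk ?rn_ps2_Win rn_ps1. Qed.

Definition rn_node l h j : option (circuit R nat) :=
  if (h == 0%N) || (h == rn_mb A) then None else Some (branch l (y l.-1) h j).

Definition rn_target k j := if k is Wmid l h then rn_node l h j else None.
Definition rn_source k i := if k is Wmid l h then rn_node l h.-1 i else None.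
Local Notation oriented := (oriented rn_target rn_source).

Lemma oriented_rn_branch l h j : (forall i, oriented None (y l.-1 i)) ->
  (h <= rn_mb A)%N -> oriented (rn_node l h j) (branch l (y l.-1) h j).
Proof.
move=> y_oriented; elim: h j => [|h IHh] j h_mb //=; split=> // i _.
have := IHh i (ltnW h_mb); rewrite /rn_node; case: eqVneq => [->//|h_neq0].
by rewrite ltn_eqF.
Qed.

Lemma oriented_rn_y l j : oriented None (y l j).
Proof.
elim: l j => [|l IHl] j; first by split.
move=> [|i] _ /=; first exact: IHl.
by have := @oriented_rn_branch l.+1 _ j IHl (leqnn _); rewrite /rn_node eqxx orbT.
Qed.

Lemma oriented_rn_out : oriented None rn_out_circuit.
Proof. by split=> // i _; exact: oriented_rn_y. Qed.

Lemma uses_rn_branch k l yc h j : uses k (branch l yc h j) ->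
  (exists2 h', (h' <= h)%N & k = Wmid l h') \/ exists i, uses k (yc i).
Proof.
elim: h j => /= [|h IHh] j; first by right; exists j.
move=> [->|[i _ k_h]]; first by left; exists h.+1.
have [[h' h'_h ->]|] : (exists2 h', (h' <= h)%N & k = Wmid l h') \/ exists i, uses k (yc i).
- by apply: (IHh i); move: k_h; case: ifP.
- by left; exists h' => //; exact: leqW.
- by right.
Qed.

Lemma uses_rn_y k l j : uses k (y l j) -> wid_upto l k.
Proof.
elim: l j => [|l IHl] j; first by move=> [->|[]].
move=> [[_ /IHl/wid_uptoS//|i _ /=]].
by move=> /uses_rn_branch[[h _ ->]/=|[i' /IHl/wid_uptoS]].
Qed.

Lemma weighted_rn_branch l yc h j : (forall i, weighted (yc i)) ->
  weighted (branch l yc h j).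
Proof. by case: h. Qed.

Lemma weighted_rn_y l j : weighted (y l j).
Proof.
elim: l j => [//|l IHl] j [|i] _ /=; first exact: IHl.
exact: weighted_rn_branch.
Qed.

Lemma rdim_mb l : rdim A l (rn_mb A) = rn_n A.
Proof. by rewrite /rdim eqxx; case: ifP. Qed.

Lemma mem_rn_keys_Win j i : (j < rn_n A)%N -> (i < rn_n0 A)%N ->
  (Win, j, i) \in rn_keys A.
Proof. by move=> j_n i_n; rewrite mem_cat mem_mat_keys. Qed.

Lemma mem_rn_keys_Wmid l h j i : (0 < l <= rn_L A)%N -> (0 < h <= rn_mb A)%N ->
  (j < rdim A l h)%N -> (i < rdim A l h.-1)%N -> (Wmid l h, j, i) \in rn_keys A.
Proof.
move=> l_L h_mb j_d i_d; rewrite !mem_cat; apply/or3P/Or32.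
apply/flatten_mapP; exists l; first by rewrite mem_iota add1n ltnS.
apply/flatten_mapP; exists h; first by rewrite mem_iota add1n ltnS.
exact: mem_mat_keys.
Qed.

Lemma mem_rn_keys_Wout i : (i < rn_n A)%N -> (Wout, 0%N, i) \in rn_keys A.
Proof. by move=> i_n; rewrite mem_cat mem_cat mem_mat_keys ?orbT. Qed.

Hypothesis mb_gt0 : (0 < rn_mb A)%N.
Hypothesis n_gt0 : (0 < rn_n A)%N.
Hypothesis d_gt0 : forall l h,
  (1 <= l <= rn_L A)%N -> (1 <= h < rn_mb A)%N -> (0 < rn_d A l h)%N.
Hypothesis alpha_gt0 : forall l, (1 <= l <= rn_L A)%N -> 0 < alpha l.
Hypothesis n0_gt0 : (0 < rn_n0 A)%N.

Lemma rdim_gt0 l h : (0 < l <= rn_L A)%N -> (h < rn_mb A)%N -> (0 < rdim A l h)%N.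
Proof.
move=> l_L h_mb; rewrite /rdim; case: eqVneq => // h_neq0; case: eqVneq => // _.
by rewrite d_gt0// lt0n h_neq0.
Qed.

Lemma top_uses_rn_branch_mb k l yc j :
  top_uses k (branch l yc (rn_mb A) j) -> k = Wmid l (rn_mb A).
Proof. by move: mb_gt0; case: (rn_mb A). Qed.

Lemma generic_rn_branch l yc h j : (0 < l <= rn_L A)%N -> (h <= rn_mb A)%N ->
  (forall i, (i < rn_n A)%N -> generic (rn_keys A) (yc i)) ->
  (forall i h', ~ uses (Wmid l h') (yc i)) ->
  (j < rdim A l h)%N -> generic (rn_keys A) (branch l yc h j).
Proof.
move=> l_L + gen_yc fresh_yc; elim: h j => [|h IHh] j h_mb j_d; first exact: gen_yc.
split=> [|i i_d]; first by rewrite isq_neq0 ?rdim_gt0.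
have gen := IHh i (ltnW h_mb) i_d.
have fresh : ~ uses (Wmid l h.+1) (branch l yc h i).
  move=> /uses_rn_branch[[h' h'_h [hE]]|[i']]; last exact: fresh_yc.
  by move: h'_h; rewrite -hE ltnn.
split; first exact: mem_rn_keys_Wmid.
- by case: (h == 0%N).
- by case: (h == 0%N) => //=; split=> //; exact: sq2_neq0.
Qed.

Lemma generic_rn_y l j : (l <= rn_L A)%N -> (j < rn_n A)%N ->
  generic (rn_keys A) (y l j).
Proof.
elim: l j => [|l IHl] j l_L j_n.
  by split=> [|i i_n]; [exact: isq_neq0|split=> //; exact: mem_rn_keys_Win].
have fresh i h : ~ uses (Wmid l.+1 h) (y l i) by move=> /uses_rn_y /=; rewrite ltnn.
move=> [_|[_|//]] /=.
  by split=> //; [exact: weighted_rn_y|exact: IHl (ltnW l_L) j_n].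
split.
- by apply: weighted_rn_branch => i; exact: weighted_rn_y.
- by move=> k [_ /top_uses_rn_branch_mb -> /=|//]; exact: fresh.
- split; first by rewrite gt_eqF// sqrtr_gt0 alpha_gt0.
  by apply: generic_rn_branch; rewrite ?rdim_mb// => i; exact: IHl (ltnW l_L).
Qed.

Lemma generic_rn_out : generic (rn_keys A) rn_out_circuit.
Proof.
split=> [|i i_n]; first exact: isq_neq0.
by split; [exact: mem_rn_keys_Wout|move=> /uses_rn_y|exact: generic_rn_y].
Qed.

Lemma Emom_rn_reduced m k : ~~ odd m -> rn_valid A k ->
  Emom (rn_keys A) (fun w => rn_reduced A alpha w x k) m
  = Emom (rn_keys A) (fun w => rn_fk A alpha w x k) m.
Proof.
move=> m_even; case: k => [_|lk hk /andP[lk_L hk_mb]|_].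
- by congr Emom; apply/funext => w; rewrite rn_fk_projection.
- rewrite /rn_reduced; under eq_fun do rewrite -relu_value_rn_out.
  under [in RHS]eq_fun do rewrite rn_fk_path_sum//.
  exact: (Emom_relu_value_path_sum oriented_rn_out generic_rn_out).
- by congr Emom; apply/funext => w; rewrite rn_fk_projection.
Qed.

End resnet.

(** * DenseNets *)

Section densenet.
Context {R : realType} (D : densenet_arch) (alpha : R) (x : nat -> R).
Implicit Types (w : weights R) (k : wid) (drop : option (nat * nat)).
Local Notation circuit := (circuit R (nat * nat)).

Fixpoint dn_tab_circuit l : nat -> nat -> circuit :=
  match l with
  | 0 => fun _ j => Scale (isq R (dn_n0 D))
      (Row Win j (dn_n0 D) (fun i => Const (x i)))
  | l'.+1 => fun h j =>
      if (h <= l')%N then dn_tab_circuit l' h j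
      else Scale (dn_scale D alpha l'.+1) (Sum l'.+1 (fun h =>
        Conn (l'.+1, h) (Row (Wmid l'.+1 h) j (dn_n D h) (fun i =>
          Scale (sq2 R) (Relu (dn_tab_circuit l' h i))))))
  end.
Local Notation tab := dn_tab_circuit.

Definition dn_out_circuit : circuit :=
  Scale (isq R (dn_n D (dn_L D))) (Row Wout 0 (dn_n D (dn_L D)) (tab (dn_L D) (dn_L D))).

Definition dn_kept drop (lh : nat * nat) : bool := dn_conn drop lh.1 lh.2.

Lemma relu_value_dn_tab drop w l h j :
  relu_value (dn_kept drop) w (tab l h j) = dn_tab D alpha w x drop l h j.
Proof.
elim: l h j => //= l IHl h j; case: ifP => // _ /=; congr (_ * _).
rewrite [RHS]big_mkcond; apply: eq_bigr => h' _; rewrite /dn_kept /=.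
by case: ifP => // _; apply: eq_bigr => i _; rewrite /relu_act IHl.
Qed.

Lemma relu_value_dn_out drop w :
  relu_value (dn_kept drop) w dn_out_circuit = dn_out D alpha w x drop.
Proof. by rewrite /=; under eq_bigr do rewrite relu_value_dn_tab. Qed.

Lemma dn_ps1 w k l : (dn_ps D alpha w x k l).1 = dn_tab D alpha w x None l.
Proof.
elim: l => //= l IHl; apply/funext => h; apply/funext => j; rewrite IHl.
case: ifP => // _; congr (_ * _); apply: eq_bigr => h' _; apply: eq_bigr => i _.
by rewrite -!mulrA gate_mul.
Qed.

Lemma ceval_dn_tab_before act w lk hk l h j : (h <= l)%N -> (h < lk)%N ->
  ceval act (dn_kept (Some (lk, hk))) w (tab l h j) =
  ceval act (dn_kept None) w (tab l h j).
Proof.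
elim: l h j => [//|l IHl] h j /=.
case: ifP => [h_l _|h_gt h_le h_lk]; first exact: IHl.
have l_lk : (l.+1 < lk)%N by move: h_gt h_le h_lk; lia.
rewrite /=; congr (_ * _); apply: eq_bigr => h' _; rewrite /dn_kept /=.
rewrite ltn_eqF// ltnNge (ltnW l_lk) /=; apply: eq_bigr => i _; rewrite IHl//.
  by rewrite -ltnS.
exact: ltn_trans l_lk.
Qed.

(* A path through [W^{lk,hk}] reaching the layer [l.+1] by an edge from the neuron
   [(h, i)] either uses that edge for [W^{lk,hk}] or already arrives through it. *)
Lemma dn_ps_last_edge w lk hk l h i : (hk < lk <= l.+1)%N -> (h <= l)%N ->
  let paths := path_sum (dn_kept None) (dn_kept (Some (lk, hk))) w (tab l h i) in
  let ps := dn_ps D alpha w x (Wmid lk hk) l in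
  ps.2 h i = (if (h < lk)%N then 0 else paths) ->
  (if Wmid lk hk == Wmid l.+1 h then ps.1 h i else ps.2 h i) =
  if dn_conn (Some (lk, hk)) l.+1 h then paths else 0.
Proof.
move=> /andP[hk_lk lk_l] h_l /= ->; rewrite Wmid_eq /dn_conn eq_sym [hk == _]eq_sym.
have [lE|l_neq] := eqVneq l.+1 lk.
  have h_lk : (h < lk)%N by rewrite -lE ltnS.
  case: eqVneq => [hE|_] /=; last by rewrite h_lk.
  by rewrite dn_ps1 ceval_dn_tab_before// path_sum_self relu_value_dn_tab.
have lk_lt : (lk < l.+1)%N by rewrite ltn_neqAle eq_sym l_neq.
by rewrite /= lk_lt; case: ltnP.
Qed.

Lemma dn_ps2_path_sum w lk hk l h j : (hk < lk)%N -> (h <= l)%N ->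
  (dn_ps D alpha w x (Wmid lk hk) l).2 h j =
  if (h < lk)%N then 0
  else path_sum (dn_kept None) (dn_kept (Some (lk, hk))) w (tab l h j).
Proof.
move=> hk_lk; elim: l h j => [|l IHl] h j h_l.
  by move: h_l; rewrite leqn0 => /eqP ->; rewrite (leq_ltn_trans (leq0n hk)).
rewrite /=; case: ifP => [|/negbT h_gt]; first exact: IHl.
have {h_gt h_l}-> : h = l.+1 by move: h_gt h_l; lia.
have ord_le (h' : 'I_l.+1) : (h' <= l)%N by rewrite -ltnS.
case: ltnP => [l_lk|lk_l].
  rewrite big1 ?mulr0// => h' _; rewrite big1// => i _.
  by rewrite Wmid_eq gtn_eqF//= IHl// (ltn_trans (ltn_ord h') l_lk) mulr0.
rewrite /=; congr (_ * _); apply: eq_bigr => h' _.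
have lk_bounds : (hk < lk <= l.+1)%N by rewrite hk_lk.
have last_edge i := dn_ps_last_edge lk_bounds (ord_le h') (IHl h' i (ord_le h')).
under eq_bigr do rewrite last_edge.
rewrite -/(dn_conn (Some (lk, hk)) l.+1 h').
case: (dn_conn _ l.+1 h'); last by rewrite big1// => i _; rewrite mulr0.
apply: eq_bigr => i _; rewrite gate_act_open_gates relu_value_dn_tab.
by rewrite !mulrA.
Qed.

Lemma dn_fk_path_sum w lk hk : (lk <= dn_L D)%N -> (hk < lk)%N ->
  dn_fk D alpha w x (Wmid lk hk) =
  path_sum (dn_kept None) (dn_kept (Some (lk, hk))) w dn_out_circuit.
Proof.
move=> lk_L hk_lk; rewrite /dn_fk /=; under eq_bigr do rewrite dn_ps2_path_sum//.
by rewrite ltnNge lk_L.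
Qed.

Lemma dn_ps2_Win w l : (dn_ps D alpha w x Win l).2 = (dn_ps D alpha w x Win l).1.
Proof.
by elim: l => //= l IHl; apply/funext => h; apply/funext => j; rewrite IHl.
Qed.

Lemma dn_fk_projection w k : is_projection k ->
  dn_fk D alpha w x k = dn_reduced D alpha w x k.
Proof. by case: k => // _; rewrite /dn_fk ?dn_ps2_Win dn_ps1. Qed.

Lemma dn_tab_circuit_diag l h : (h <= l)%N -> tab l h = tab h h.
Proof.
elim: l => [|l IHl] h_l; first by move: h_l; rewrite leqn0 => /eqP ->.
have [h_l'|l_h] := leqP h l; last by have -> : h = l.+1 by move: h_l l_h; lia.
by rewrite -IHl//; apply/funext => j /=; rewrite h_l'.
Qed.

Definition dn_node l j : option circuit :=
  if (l < dn_L D)%N then Some (tab l l j) else None.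

Definition dn_target k j :=
  match k with Win => dn_node 0 j | Wmid l _ => dn_node l j | Wout => None end.
Definition dn_source k i := if k is Wmid _ h then dn_node h i else None.
Local Notation oriented := (oriented dn_target dn_source).

Lemma oriented_dn_tab l h j : (h <= l)%N -> (l <= dn_L D)%N ->
  oriented (dn_node h j) (tab l h j).
Proof.
elim: l h j => [|l IHl] h j h_l l_L /=.
  by move: h_l; rewrite leqn0 => /eqP ->; split.
case: ifP => [h_l'|/negbT h_gt]; first by apply: IHl => //; exact: ltnW.
have {h_gt h_l}-> : h = l.+1 by move: h_gt h_l; lia.
move=> h' h'_l; split=> // i _ /=; have := IHl h' i h'_l (ltnW l_L).
by rewrite /dn_node (leq_trans h'_l l_L) (dn_tab_circuit_diag (h'_l : h' <= l)%N).
Qed.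

Lemma oriented_dn_out : oriented None dn_out_circuit.
Proof.
split=> // i _; have := oriented_dn_tab i (leqnn (dn_L D)) (leqnn _).
by rewrite /dn_node ltnn.
Qed.

Lemma uses_dn_tab k l h j : uses k (tab l h j) -> wid_upto l k.
Proof.
elim: l h j => [|l IHl] h j; first by move=> [->|[]].
rewrite /=; case: ifP => _ /=; first by move=> /IHl/wid_uptoS.
by move=> [h' _ [->/=|[i _ /IHl/wid_uptoS]]].
Qed.

Lemma mem_dn_keys_Win j i : (j < dn_n D 0)%N -> (i < dn_n0 D)%N ->
  (Win, j, i) \in dn_keys D.
Proof. by move=> j_n i_n; rewrite mem_cat mem_mat_keys. Qed.

Lemma mem_dn_keys_Wmid l h j i : (0 < l <= dn_L D)%N -> (h < l)%N ->
  (j < dn_n D l)%N -> (i < dn_n D h)%N -> (Wmid l h, j, i) \in dn_keys D.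
Proof.
move=> l_L h_l j_n i_n; rewrite !mem_cat; apply/or3P/Or32.
apply/flatten_mapP; exists l; first by rewrite mem_iota add1n ltnS.
apply/flatten_mapP; exists h; first by rewrite mem_iota.
exact: mem_mat_keys.
Qed.

Lemma mem_dn_keys_Wout i : (i < dn_n D (dn_L D))%N -> (Wout, 0%N, i) \in dn_keys D.
Proof. by move=> i_n; rewrite mem_cat mem_cat mem_mat_keys ?orbT. Qed.

Hypothesis n_gt0 : forall l, (l <= dn_L D)%N -> (0 < dn_n D l)%N.
Hypothesis alpha_gt0 : 0 < alpha.
Hypothesis n0_gt0 : (0 < dn_n0 D)%N.

Lemma dn_scale_neq0 l : (0 < l <= dn_L D)%N -> dn_scale D alpha l != 0.
Proof.
move=> /andP[l_gt0 l_L]; rewrite gt_eqF// sqrtr_gt0 divr_gt0// -natrM ltr0n.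
by rewrite muln_gt0 l_gt0 andbT n_gt0// (leq_trans (leq_pred l)).
Qed.

Lemma generic_dn_tab l h j : (h <= l)%N -> (l <= dn_L D)%N -> (j < dn_n D h)%N ->
  generic (dn_keys D) (tab l h j).
Proof.
elim: l h j => [|l IHl] h j h_l l_L j_n.
  move: h_l j_n; rewrite leqn0 => /eqP -> j_n.
  by split=> [|i i_n]; [exact: isq_neq0|split=> //; exact: mem_dn_keys_Win].
rewrite /=; case: ifP => [h_l'|/negbT h_gt]; first by apply: IHl => //; exact: ltnW.
have hE : h = l.+1 by move: h_gt h_l; lia.
move: j_n; rewrite hE => j_n.
have fresh h' h'' i : ~ uses (Wmid l.+1 h') (tab l h'' i).
  by move=> /uses_dn_tab /=; rewrite ltnn.
split=> [|h' h'_l]; first exact: dn_scale_neq0.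
split=> [//|k h'' h''_h' /= ->|/= i i_n].
  move=> [[h'E]|[i _]]; last exact: fresh.
  by move: h''_h'; rewrite h'E ltnn.
split; [exact: mem_dn_keys_Wmid|exact: fresh|split; first exact: sq2_neq0].
by apply: IHl => //; exact: ltnW.
Qed.

Lemma generic_dn_out : generic (dn_keys D) dn_out_circuit.
Proof.
split=> [|i i_n]; first by rewrite isq_neq0 ?n_gt0.
by split; [exact: mem_dn_keys_Wout|move=> /uses_dn_tab|exact: generic_dn_tab].
Qed.

Lemma Emom_dn_reduced m k : ~~ odd m -> dn_valid D k ->
  Emom (dn_keys D) (fun w => dn_reduced D alpha w x k) m
  = Emom (dn_keys D) (fun w => dn_fk D alpha w x k) m.
Proof.
move=> m_even; case: k => [_|lk hk /andP[/andP[_ lk_L] hk_lk]|_].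
- by congr Emom; apply/funext => w; rewrite dn_fk_projection.
- rewrite /dn_reduced; under eq_fun do rewrite -relu_value_dn_out.
  under [in RHS]eq_fun do rewrite dn_fk_path_sum//.
  exact: (Emom_relu_value_path_sum oriented_dn_out generic_dn_out).
- by congr Emom; apply/funext => w; rewrite dn_fk_projection.
Qed.

End densenet.

Theorem theorem1 (R : realType) :
  (* ResNet *)
  (forall (A : resnet_arch) (alpha : nat -> R) (x : nat -> R),
     (0 < rn_mb A)%N ->
     (0 < rn_n A)%N ->
     (forall l h, (1 <= l <= rn_L A)%N -> (1 <= h < rn_mb A)%N -> (0 < rn_d A l h)%N) ->
     (forall l, (1 <= l <= rn_L A)%N -> 0 < alpha l) ->
     Num.sqrt (\sum_(i < rn_n0 A) x i ^+ 2) = 1 ->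
     forall (m : nat), ~~ odd m ->
     forall k : wid, rn_valid A k ->
       Emom (rn_keys A) (fun w => rn_reduced A alpha w x k) m
       = Emom (rn_keys A) (fun w => rn_fk A alpha w x k) m)
  /\
  (* DenseNet *)
  (forall (D : densenet_arch) (alpha : R) (x : nat -> R),
     (forall l, (l <= dn_L D)%N -> (0 < dn_n D l)%N) ->
     0 < alpha ->
     Num.sqrt (\sum_(i < dn_n0 D) x i ^+ 2) = 1 ->
     forall (m : nat), ~~ odd m ->
     forall k : wid, dn_valid D k ->
       Emom (dn_keys D) (fun w => dn_reduced D alpha w x k) m
       = Emom (dn_keys D) (fun w => dn_fk D alpha w x k) m).
Proof.
split=> [A alpha x mb_gt0 n_gt0 d_gt0 alpha_gt0 x_norm m m_even k k_valid
        |D alpha x n_gt0 alpha_gt0 x_norm m m_even k k_valid].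
  by apply: Emom_rn_reduced => //; exact: unit_vector_dim_gt0 x_norm.
by apply: Emom_dn_reduced => //; exact: unit_vector_dim_gt0 x_norm.
Qed.
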